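(* For every prime $p\geq 3$ and every integer $\alpha\geq 1$, $$ rb(\mathbb{Z}_{p^\alpha},p)=\begin{cases}3 & p=3,\ \alpha=1,\\ 4 & p=3,\ \alpha\geq 2,\\ \frac{p+1}{2}+1 & p\geq 5.\end{cases}$$
   Context: $\mathbb{Z}_n$ denotes the cyclic group of order $n$. An $r$-coloring of $\mathbb{Z}_n$ is a surjective map $c:\mathbb{Z}_n\to\{1,\dots,r\}$. For a fixed integer $k$, a triple is any $(x_1,x_2,x_3)\in\mathbb{Z}_n^3$ with $x_1+x_2\equiv kx_3 \pmod n$. A triple is rainbow under $c$ if $c(x_1),c(x_2),c(x_3)$ are pairwise distinct; $c$ is rainbow-free if no triple is rainbow. The rainbow number $rb(\mathbb{Z}_n,k)$ is the smallest positive integer $r$ such that every $r$-coloring of $\mathbb{Z}_n$ admits a rainbow triple (by convention $rb(\mathbb{Z}_n,k)=n+1$ if no such $r$ exists). *)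

(* Defs.v *)
(* MathComp *)
From mathcomp Require Import all_boot all_order all_algebra.

Set Implicit Arguments.
Unset Strict Implicit.
Unset Printing Implicit Defensive.

(* Z_n is represented by 'I_n, its elements being the residues 0, ..., n - 1,
   and the colors 1, ..., r are represented by 'I_r. *)

Definition is_triple (n : nat) (k : int) (x1 x2 x3 : 'I_n) : bool :=
  (x1%:Z + x2%:Z == k * x3%:Z %[mod n%:Z])%Z.

Definition is_coloring (n r : nat) (c : {ffun 'I_n -> 'I_r}) : bool :=
  [forall i : 'I_r, exists x : 'I_n, c x == i].

Definition is_rainbow (n r : nat) (c : {ffun 'I_n -> 'I_r})
    (x1 x2 x3 : 'I_n) : bool :=
  [&& c x1 != c x2, c x1 != c x3 & c x2 != c x3].

Definition rainbow_free (n r : nat) (k : int) (c : {ffun 'I_n -> 'I_r}) : bool :=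
  [forall x1 : 'I_n, forall x2 : 'I_n, forall x3 : 'I_n,
     is_triple k x1 x2 x3 ==> ~~ is_rainbow c x1 x2 x3].

Definition forces_rainbow (n : nat) (k : int) (r : nat) : bool :=
  (0 < r) &&
  [forall c : {ffun 'I_n -> 'I_r}, is_coloring c ==> ~~ rainbow_free k c].

Lemma forces_rainbow_ex (n : nat) (k : int) : exists r, forces_rainbow n k r.
Proof.
exists n.+1; rewrite /forces_rainbow /=.
apply/forallP => c; apply/implyP => /forallP surj_c; exfalso.
have : #|codom c| = n.+1.
  rewrite -[RHS](card_ord n.+1); apply: eq_card => i.
  rewrite inE; have /existsP[x /eqP <-] := surj_c i.
  exact: codom_f.
by move=> card_c; have := leq_image_card c predT; rewrite card_c card_ord ltnn.
Qed.

(* There is no surjection 'I_n -> 'I_(n.+1), so [forces_rainbow n k n.+1] holds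
   vacuously: the minimum always exists, and it is n.+1 exactly when every
   0 < r <= n admits a rainbow-free r-coloring. *)
Definition rb (n : nat) (k : int) : nat := ex_minn (forces_rainbow_ex n k).

(* Main.v *)
(** Extend a coloring of Z_(p^k) to a periodic coloring c of the integers; it is
    rainbow-free iff c x, c (p y - x), c y are never pairwise distinct, i.e. the
    reflection rho_y : x |-> p y - x preserves the color of x unless x or its
    image has the color of y.  As this condition does not mention k, one can show
    by induction on k that at least four colors means at most (p + 1) / 2 colors.

    If the multiples of p are not monochromatic, they bear all the colors: a color
    missing there would live in a single class mod p, and the contraction
    y |-> p y - x at a point x of that color would preserve every other color,
    although all its orbits merge modulo p^k.  Then c (p z) has a smaller period.

    If the multiples of p are monochromatic, c itself has period p^(k-1).
    Otherwise some y, y' differing by a multiple of p^(k-1) have distinct colors;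
    rho_y = rho_y' then preserves all other colors.  By the contraction argument
    there is such a pair u, u' with u = - y mod p, and the translation
    rho_u rho_y makes every color preserved by both reflections a union of classes
    mod p.  Reflections at points of such a color preserve all colors; this spreads
    to all the colors, which contradicts c y <> c y'.

    The extremal colorings are x |-> {x, -x} mod p and, when p = 3, k >= 2, the
    partition into 3 | x, x = 1 or -1 mod 9, and the rest. *)

Require Import Defs.
From mathcomp Require Import all_boot all_order all_algebra.
From mathcomp Require Import zify ring.
From Stdlib Require Import Classical.

(** * Rainbow-free periodic colorings of the integers *)

Section PeriodicColorings.

Import GRing.Theory Num.Theory.
Local Open Scope ring_scope.

Variables (p : nat) (T : eqType).
Hypotheses (p_prime : prime p) (p_gt2 : (2 < p)%N).

Implicit Types (c : int -> T) (m x y t : int) (s l : seq T) (K : T).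

Definition periodic m c := forall x t, c (x + m * t) = c x.

Definition no_rainbow c :=
  forall x y, [|| c x == c (p%:Z * y - x), c x == c y | c (p%:Z * y - x) == c y].

Definition attained c s := forall v, v \in s -> exists x, c x = v.

Lemma no_rainbowP c x y : no_rainbow c -> c x != c y ->
  c (p%:Z * y - x) = c x \/ c (p%:Z * y - x) = c y.
Proof.
move=> rf ne; have := rf x y; rewrite (negPf ne) /=.
by case/orP=> /eqP ->; [left | right].
Qed.

Lemma attained_fresh c s l : uniq s -> attained c s -> (size l < size s)%N ->
  exists x, c x \notin l.
Proof.
move=> us cs ltls.
have /hasP[v vs vl] : has [predC l] s.
  apply: contraLR ltls; rewrite -all_predC -leqNgt => /allP sl.
  by apply: uniq_leq_size => // v /sl /= /negbNE.
by have [x cx] := cs v vs; exists x; rewrite cx.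
Qed.

Lemma coprime_pE x : coprimez x p%:Z = ~~ (p%:Z %| x)%Z.
Proof. by rewrite coprimez_sym /coprimez /gcdz dvdzE /= -prime_coprime. Qed.

Lemma dvdp_double x : ~~ (p%:Z %| x)%Z -> ~~ (p%:Z %| 2 * x)%Z.
Proof.
rewrite !dvdzE abszM Euclid_dvdM // negb_or => ->; rewrite andbT.
by apply/negP => /dvdn_leq; lia.
Qed.

Lemma dvdp_subMr x y : (p%:Z %| x - p%:Z * y)%Z = (p%:Z %| x)%Z.
Proof. by rewrite rpredBr ?dvdz_mulr. Qed.

(** By Bezout [t] is a multiple of [d] modulo [p ^ k], and the coefficient may be reduced to a
    natural number, so forward steps suffice. *)
Lemma transl_closed (P : int -> Prop) m d k :
    coprimez d p%:Z -> (forall x, P x -> P (x + m * d)) ->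
    (forall x t, P x -> P (x + m * (p%:Z ^+ k * t))) ->
  forall x t, P x -> P (x + m * t).
Proof.
move=> cop Pd Pk x t Px.
have [u [v uv]] : exists u v : int, u * d + v * p%:Z ^+ k = 1.
  have := coprimezXr k cop; rewrite /coprimez => /eqP g1.
  by have [u [v uv]] := Bezoutz d (p%:Z ^+ k); exists u, v; rewrite uv g1.
have n0 : p%:Z ^+ k != 0 by rewrite expf_neq0 //; lia.
have Piter n z : P z -> P (z + m * (n%:Z * d)).
  elim: n => [|n IHn] Pz; first by rewrite mul0r mulr0 addr0.
  have -> : z + m * (n.+1%:Z * d) = z + m * (n%:Z * d) + m * d.
    by rewrite intS; ring.
  exact/Pd/IHn.
have := divz_eq (t * u) (p%:Z ^+ k).
have := modz_ge0 (t * u) n0.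
case: ((t * u) %% p%:Z ^+ k)%Z => // n _ def_tu.
have -> : x + m * t =
    x + m * (n%:Z * d) + m * (p%:Z ^+ k * (((t * u) %/ p%:Z ^+ k)%Z * d + t * v)).
  have {1}-> : t = (t * u) * d + t * (v * p%:Z ^+ k).
    by rewrite -mulrA -mulrDr uv mulr1.
  by rewrite [in LHS]def_tu; ring.
exact/Pk/Piter.
Qed.

(** Each application of [y |-> p y - x] multiplies the difference of two points by [p], so after [k]
    steps their orbits meet modulo the period. *)
Lemma contraction_unique c k x K1 K2 : periodic (p%:Z ^+ k) c ->
    (forall y, c y = K1 -> c (p%:Z * y - x) = K1) ->
    (forall y, c y = K2 -> c (p%:Z * y - x) = K2) ->
    (exists y, c y = K1) -> (exists y, c y = K2) ->
  K1 = K2.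
Proof.
move=> per h1 h2 [y1 e1] [y2 e2].
pose f y := p%:Z * y - x.
have fK K y n : (forall y, c y = K -> c (f y) = K) -> c y = K -> c (iter n f y) = K.
  by move=> hK ey; elim: n => //= n IHn; apply: hK.
have fD n : iter n f y1 = iter n f y2 + p%:Z ^+ n * (y1 - y2).
  elim: n => [|n IHn] /=; first by rewrite expr0; ring.
  by rewrite IHn /f exprS; ring.
by rewrite -(fK _ y1 k h1 e1) -(fK _ y2 k h2 e2) fD per.
Qed.

Lemma colors_prime c s : periodic p%:Z c -> no_rainbow c ->
    uniq s -> attained c s -> (2 < size s)%N ->
  (size s <= (p + 1) %/ 2)%N.
Proof.
move=> per rf us cs s_gt2.
(* Modulo [p] every reflection is negation; one at a point of a third color forces the equality. *)
have symc x : c (- x) = c x.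
  apply/eqP; apply: contraTT isT => ne.
  have [y] := @attained_fresh c s [:: c x; c (- x)] us cs s_gt2.
  rewrite !inE negb_or => /andP[n1 n2].
  have := rf x y; rewrite addrC per (eq_sym (c x) (c (- x))) (negPf ne) /=.
  by rewrite eq_sym (negPf n1) eq_sym (negPf n2).
have -> : ((p + 1) %/ 2)%N = size [seq c i%:Z | i <- iota 0 ((p + 1) %/ 2)].
  by rewrite size_map size_iota.
apply: uniq_leq_size => // v /cs [x <-].
have p0 : p%:Z != 0 by lia.
have ex := divz_eq x p%:Z; have := modz_ge0 x p0.
have := ltz_pmod x (_ : 0 < p%:Z); move=> /(_ ltac:(lia)).
move: ex; case: (x %% p%:Z)%Z => // n ex lt_np _.
have -> : c x = c n%:Z by rewrite ex addrC mulrC per.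
have [le_n|gt_n] := leqP n ((p - 1) %/ 2).
  by apply: map_f; rewrite mem_iota; lia.
have -> : c n%:Z = c (p - n)%N%:Z.
  by rewrite -symc -(per _ 1); congr c; lia.
have [p_even|p_odd] := even_prime p_prime; first by lia.
by apply: map_f; rewrite mem_iota; lia.
Qed.

Lemma multiples_all_colors c k : periodic (p%:Z ^+ k) c -> no_rainbow c ->
    (exists z, c (p%:Z * z) != c 0) ->
  forall x, exists z, c (p%:Z * z) = c x.
Proof.
move=> per rf [z0 nz0] x; apply: NNPP => hx.
pose S y := ~ exists z, c (p%:Z * z) = c y.
have neS y z : S y -> c y != c (p%:Z * z).
  by move=> Sy; apply/eqP => e; apply: Sy; exists z.
have refl y a : S y -> c (p%:Z * (y - a)) = c (p%:Z * a).
  move=> Sy; have := rf (p%:Z * a) y; rewrite -mulrBr.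
  rewrite eq_sym [_ == c y]eq_sym [c (_ * (_ - _)) == c y]eq_sym.
  by rewrite (negPf (neS y a Sy)) (negPf (neS y (y - a) Sy)) !orbF => /eqP.
(* Reflecting a multiple of [p] at both points translates it by [p * (x - y)]; were [x - y] prime to
   [p], all multiples would share one color. *)
have Smod y : S y -> (p%:Z %| x - y)%Z.
  move=> Sy; apply: contraTT isT => ndiv.
  case/eqP: nz0; pose P a := c (p%:Z * a) = c 0.
  suff : P (0 + 1 * z0) by rewrite /P add0r mul1r.
  apply: (@transl_closed P 1 (x - y) k); rewrite ?coprime_pE //.
  - rewrite /P => a <-; rewrite -(refl y a Sy) -(refl x (y - a) hx).
    by congr (c (_ * _)); ring.
  - rewrite /P => a t <-; rewrite -(per (p%:Z * a) (p%:Z * t)); congr c; ring.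
  - by rewrite /P mulr0.
have nx : ~~ (p%:Z %| x)%Z.
  by apply/negP => /dvdzP[z ez]; apply: hx; exists z; rewrite ez mulrC.
have n2x := dvdp_double x nx.
(* [p * y - x] is in the class of [- x], not of [x], so its color occurs on the multiples and is not
   [c x]. *)
have stay y z : c y = c (p%:Z * z) -> c (p%:Z * y - x) = c (p%:Z * z).
  move=> ey.
  have nS : ~ S (p%:Z * y - x).
    move=> /Smod; have -> : x - (p%:Z * y - x) = 2 * x - p%:Z * y by ring.
    by rewrite dvdp_subMr (negPf n2x).
  have [z' ez'] := NNPP _ nS.
  have ne : c x != c y by rewrite ey; apply: neS.
  have [] := no_rainbowP c x y rf ne; last by rewrite ey.
  by move=> e; case/eqP: (neS x z' hx); rewrite ez' e.
have e0 : c (p%:Z * 0) = c 0 by rewrite mulr0.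
case/eqP: nz0; apply: (@contraction_unique c k x) => //.
- by move=> y; apply: stay.
- by rewrite -e0 => y; apply: stay.
- by exists (p%:Z * z0).
- by exists 0.
Qed.

Definition class_closed (P : int -> Prop) := forall x t, P x -> P (x + p%:Z * t).

(** The two reflections compose to the translation by [p * (y' - y)], which generates all
    translations by multiples of [p] modulo the period. *)
Lemma reflections_closed c k (P : T -> Prop) y y' : periodic (p%:Z ^+ k) c ->
    coprimez (y' - y) p%:Z ->
    (forall x, P (c x) -> P (c (p%:Z * y - x))) ->
    (forall x, P (c x) -> P (c (p%:Z * y' - x))) ->
  class_closed (fun x => P (c x)).
Proof.
move=> per cop h h'; apply: (@transl_closed _ _ _ k cop) => [x /h /h'|x t].
  by congr (P (c _)); ring.
by rewrite mulrCA per.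
Qed.

(** The reflections at [e] and [w] differ by a multiple of [p], so the one at [e] keeps its own
    color too; as an involution, it sends no other color there. *)
Lemma closed_reflection c w e : no_rainbow c ->
    class_closed (fun x => c x = c e) ->
    (forall x, c x = c e -> c (p%:Z * w - x) = c e) ->
  forall x, c (p%:Z * e - x) = c x.
Proof.
move=> rf cl hw.
have he x : c x = c e -> c (p%:Z * e - x) = c e.
  move=> /hw /(cl _ (e - w)) <-; congr c; ring.
move=> x; have [ex|nx] := eqVneq (c x) (c e); first by rewrite he.
have [//|ey] := no_rainbowP c x e rf nx.
case/eqP: nx; rewrite -(he _ ey); congr c; ring.
Qed.

Lemma shorter_period c k s : (0 < k)%N -> periodic (p%:Z ^+ k.+1) c ->
    no_rainbow c -> uniq s -> attained c s -> (3 < size s)%N ->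
    (forall z, c (p%:Z * z) = c 0) ->
  periodic (p%:Z ^+ k) c.
Proof.
move=> k0 per rf us cs s_gt3 mono y t; apply/eqP; apply: contraTT isT => ne.
set h := p%:Z ^+ k * t in ne; pose y' := y + h.
rewrite -/y' eq_sym in ne.
have ph x : c (x + p%:Z * h) = c x by rewrite /h mulrA -exprS per.
have [h' eh] : exists h', h = p%:Z * h'.
  by exists (p%:Z ^+ k.-1 * t); rewrite mulrA -exprS prednK.
(* [p u = p u'] modulo the period, so [u] and [u'] define the same reflection. *)
have twin u u' : u' = u + h \/ u = u' + h -> c u != c u' ->
    forall x, c (p%:Z * u - x) = c x \/
      (c x \in [:: c u; c u']) /\ (c (p%:Z * u - x) \in [:: c u; c u']).
  move=> uu' nuu' x.
  have eu : c (p%:Z * u' - x) = c (p%:Z * u - x).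
    by case: uu' => ->; [rewrite -(ph (p%:Z * u - x))|rewrite -(ph (p%:Z * u' - x))];
      congr c; ring.
  have := rf x u; have := rf x u'; rewrite eu !inE.
  have [//->|n1] := eqVneq (c x) (c (p%:Z * u - x)); first by left.
  move=> /= /orP[/eqP e1|/eqP e1] /orP[/eqP e2|/eqP e2].
  - by rewrite -e1 -e2 eqxx in nuu'.
  - by right; rewrite e1 e2 !eqxx orbT.
  - by right; rewrite e1 e2 !eqxx orbT.
  - by rewrite -e1 -e2 eqxx in nuu'.
have fixc u u' K : u' = u + h \/ u = u' + h -> c u != c u' ->
    K \notin [:: c u; c u'] -> forall x, c x = K -> c (p%:Z * u - x) = K.
  move=> uu' nuu' nK x ex; case: (twin u u' uu' nuu' x) => [->//|[]].
  by rewrite ex (negPf nK).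
have ny : ~~ (p%:Z %| y)%Z.
  apply/negP => /dvdzP[z ez]; case/eqP: ne.
  by rewrite /y' ez eh mulrC -mulrDr !mono.
have n2y := dvdp_double y ny.
have hyy' : y' = y + h \/ y = y' + h by left.
(* Otherwise [z |-> p z - y] keeps every color but perhaps [c y] and [c y'], and at least two such
   colors remain. *)
have [m nm] : exists m, c (p%:Z * m - y) != c (p%:Z * m - y').
  apply: NNPP => hm.
  have {}hm m : c (p%:Z * m - y) = c (p%:Z * m - y').
    by apply/eqP; apply: contraTT isT => nm; case: hm; exists m.
  have stay K : K \notin [:: c y; c y'] ->
      forall z, c z = K -> c (p%:Z * z - y) = K.
    rewrite !inE negb_or => /andP[nK nK'] z ez.
    have [] := no_rainbowP c y z rf; [by rewrite ez eq_sym| |by rewrite ez].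
    rewrite hm => e; have [] := no_rainbowP c y' z rf;
      [by rewrite ez eq_sym| |by rewrite ez].
    by rewrite e => e'; rewrite e' eqxx in ne.
  have [d nd] := @attained_fresh c s [:: c y; c y'] us cs (ltnW s_gt3).
  have [e] := @attained_fresh c s [:: c d; c y; c y'] us cs s_gt3.
  rewrite in_cons negb_or => /andP[/eqP ned ne'].
  apply: ned; apply: (@contraction_unique c k.+1 y) => //.
  - exact: stay.
  - exact: stay.
  - by exists e.
  - by exists d.
set u := p%:Z * m - y in nm; set u' := p%:Z * m - y' in nm.
have huu' : u' = u + h \/ u = u' + h by right; rewrite /u /u' /y'; ring.
have cop_uy : coprimez (u - y) p%:Z.
  rewrite coprime_pE; have -> : u - y = - (2 * y - p%:Z * m) by rewrite /u; ring.
  by rewrite rpredN dvdp_subMr.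
(* Were the two pairs of colors disjoint, the second one would be a union of
   classes mod p stable under negation, hence contain the color of [y]. *)
have [w uw] : exists w, {subset [:: c u; c u'] <= [:: w; c y; c y']}.
  pose P v := v \in [:: c u; c u'].
  have [uy|nuy] := boolP (c u \in [:: c y; c y']).
    by exists (c u') => v; rewrite in_cons [in X in _ -> X]in_cons orbC
      mem_seq1 => /orP[->//|/eqP->]; rewrite uy orbT.
  have [uy'|nuy'] := boolP (c u' \in [:: c y; c y']).
    by exists (c u) => v; rewrite in_cons [in X in _ -> X]in_cons
      mem_seq1 => /orP[->//|/eqP->]; rewrite uy' orbT.
  have outP v : P v -> v \notin [:: c y; c y'].
    by rewrite /P in_cons mem_seq1 => /orP[] /eqP ->.
  have closedP : class_closed (fun x => P (c x)).
    apply: (@reflections_closed c k.+1 P y u per cop_uy) => x Px.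
      by rewrite (fixc y y' (c x) hyy' ne) // outP.
    by case: (twin u u' huu' nm x) => [->|[]].
  have Pu : P (c u) by rewrite /P mem_head.
  have := closedP (p%:Z * y - u) (m - y).
  rewrite (fixc y y' (c u) hyy' ne) // => /(_ Pu).
  have -> : p%:Z * y - u + p%:Z * (m - y) = y by rewrite /u; ring.
  by move=> /outP; rewrite mem_head.
have [e] := @attained_fresh c s [:: w; c y; c y'] us cs s_gt3.
move=> ew.
have eu : c e \notin [:: c u; c u'] by apply: contra ew => /uw.
have ey : c e \notin [:: c y; c y'].
  by apply: contra ew => ey; rewrite in_cons ey orbT.
have fixy := fixc y y' _ hyy' ne.
have closed_e : class_closed (fun x => c x = c e).
  apply: (@reflections_closed c k.+1 (eq^~ (c e)) y u per cop_uy) => x.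
    exact: fixy.
  exact: fixc huu' nm eu x.
have fix_e := closed_reflection c y e rf closed_e (fixy _ ey).
have cop_e z : c z != c e -> coprimez (e - z) p%:Z.
  rewrite coprime_pE; apply: contraNN => /dvdzP[q eq]; apply/eqP.
  rewrite -(closed_e e (- q) erefl); congr c.
  by rewrite mulrN [p%:Z * q]mulrC -eq; ring.
have [d] := @attained_fresh c s [:: c e; c y; c y'] us cs s_gt3.
rewrite in_cons negb_or => /andP[de dy].
have closed_d : class_closed (fun x => c x = c d).
  apply: (@reflections_closed c k.+1 (eq^~ (c d)) y e per).
  - by apply: cop_e; apply: contraNneq ey => <-; rewrite mem_head.
  - exact: fixy.
  - by move=> x; rewrite fix_e.
have fix_d := closed_reflection c y d rf closed_d (fixy _ dy).
(* The reflections at [d] and [e] preserve all colors, hence even the color of [y] is a union of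
   classes mod [p], while [y'] is in the class of [y]. *)
have closed_y : class_closed (fun x => c x = c y).
  by apply: (@reflections_closed c k.+1 (eq^~ (c y)) d e per (cop_e d de)) => x;
    rewrite ?fix_d ?fix_e.
by case/eqP: ne; rewrite /y' eh closed_y.
Qed.

Lemma colors_prime_power c k s : (0 < k)%N -> periodic (p%:Z ^+ k) c ->
    no_rainbow c -> uniq s -> attained c s -> (3 < size s)%N ->
  (size s <= (p + 1) %/ 2)%N.
Proof.
case: k => // k _; elim: k c => [|k IHk] c per rf us cs s_gt3.
  by apply: (@colors_prime c s) => //; apply: ltnW.
have [mono|nmono] := classic (forall z, c (p%:Z * z) = c 0).
  by apply: (IHk c) => //; apply: (@shorter_period c k.+1 s).
have all_c := @multiples_all_colors c k.+2 per rf.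
apply: (IHk (fun z => c (p%:Z * z))) => //.
- by move=> x t; rewrite -(per (p%:Z * x) t); congr c; rewrite [in RHS]exprS; ring.
- move=> x y; have := rf (p%:Z * x) (p%:Z * y).
  by rewrite -mulrBr.
- move=> v /cs[x <-]; apply: all_c.
  apply: NNPP => h; apply: nmono => z; apply/eqP; apply: contraTT isT => nz.
  by case: h; exists z.
Qed.

End PeriodicColorings.

Lemma PoszX (m k : nat) : Posz (m ^ k) = (Posz m ^+ k)%R.
Proof. by elim: k => // k IHk; rewrite expnS PoszM IHk GRing.exprS. Qed.

(** * Lifting colorings of the cyclic group to the integers *)

Section ResidueColorings.

Import GRing.Theory Num.Theory.
Local Open Scope ring_scope.

Variables (n : nat) (n_gt0 : (0 < n)%N).

Lemma residue_subproof (x : int) : (`|(x %% n%:Z)%Z| < n)%N.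
Proof.
have n0 : n%:Z != 0 by lia.
by rewrite -ltz_nat gez0_abs ?modz_ge0 // ltz_pmod.
Qed.

Definition residue (x : int) : 'I_n := Ordinal (residue_subproof x).

Lemma residueE x : (residue x)%:Z = (x %% n%:Z)%Z.
Proof. by rewrite /= gez0_abs // modz_ge0 //; lia. Qed.

Lemma residueK (i : 'I_n) : residue i%:Z = i.
Proof. by apply: val_inj; rewrite /= modz_nat modn_small. Qed.

Lemma residue_periodic x t : residue (x + n%:Z * t) = residue x.
Proof. by apply: val_inj; rewrite /= addrC mulrC modzMDl. Qed.

Lemma residue_triple (k : int) x y :
  is_triple k (residue x) (residue (k * y - x)) (residue y).
Proof.
by rewrite /is_triple !residueE modzDm modzMmr addrCA subrr addr0.
Qed.

Lemma residue_no_rainbow (p r : nat) (c : {ffun 'I_n -> 'I_r}) :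
  rainbow_free p%:Z c -> no_rainbow p _ (fun x => c (residue x)).
Proof.
move=> /forallP rf x y.
have /forallP/(_ (residue (p%:Z * y - x)))/forallP/(_ (residue y)) :=
  rf (residue x).
by rewrite residue_triple /= /is_rainbow !negb_and !negbK.
Qed.

Lemma residue_attained (r : nat) (c : {ffun 'I_n -> 'I_r}) :
  is_coloring c -> attained _ (fun x => c (residue x)) (enum 'I_r).
Proof.
move=> /forallP surj_c i _; have /existsP[x /eqP cx] := surj_c i.
by exists x%:Z; rewrite residueK.
Qed.

End ResidueColorings.

(** * Upper and lower bounds for the rainbow number *)

Lemma forces_rainbow_above (p k r : nat) : prime p -> 2 < p -> 0 < k ->
    (p + 1) %/ 2 < r -> k = 1 /\ 2 < r \/ 3 < r ->
  forces_rainbow (p ^ k) (Posz p) r.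
Proof.
move=> p_prime p_gt2 k_gt0 ltr kr; apply/andP; split; first by lia.
apply/forallP => c; apply/implyP => surj_c; apply/negP => rf.
have n_gt0 : 0 < p ^ k by rewrite expn_gt0 prime_gt0.
have norb := residue_no_rainbow _ n_gt0 _ _ _ rf.
have att := residue_attained _ n_gt0 _ _ surj_c.
have per : periodic _ (Posz p ^+ k)%R (fun x => c (residue _ n_gt0 x)).
  by move=> x t; rewrite -PoszX residue_periodic.
move: ltr; rewrite ltnNge => /negP; apply.
case: kr => [[k1 r_gt2]|r_gt3].
  subst k; have := colors_prime p _ p_prime p_gt2 _ (enum 'I_r) per.
  by rewrite size_enum_ord; apply=> //; apply: enum_uniq.
have := colors_prime_power p _ p_prime p_gt2 _ k (enum 'I_r) k_gt0 per.
by rewrite size_enum_ord; apply=> //; apply: enum_uniq.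
Qed.

(* Capping [g] at [q] merges its top colors, which yields all smaller palettes. *)
Lemma not_forces_rainbow (n k r : nat) (g : nat -> nat) :
    (forall i, i < r -> exists2 x, x < n & g x = i) ->
    (forall x1 x2 x3, x1 + x2 = k * x3 %[mod n] ->
       forall q, [|| minn (g x1) q == minn (g x2) q,
         minn (g x1) q == minn (g x3) q | minn (g x2) q == minn (g x3) q]) ->
  ~~ forces_rainbow n (Posz k) r.
Proof.
case: r => [|q] surj_g rf //; rewrite /forces_rainbow /=.
apply/negP => /forallP/(_ [ffun x : 'I_n => inord (minn (g x) q)]) /implyP.
case/(_ _)/negP.
  apply/forallP => i; have [x ltxn gx] := surj_g i (ltn_ord i).
  apply/existsP; exists (Ordinal ltxn); rewrite ffunE /= gx.
  by rewrite (minn_idPl _) ?inord_val // -ltnS.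
apply/forallP => x1; apply/forallP => x2; apply/forallP => x3.
apply/implyP; rewrite /is_triple -PoszD -PoszM !modz_nat => /eqP[eqx].
rewrite /is_rainbow !ffunE !negb_and !negbK -!val_eqE /=.
by rewrite !inordK ?ltnS ?geq_minr //; apply: rf.
Qed.

(** In a triple [x1] and [x2] are opposite mod [p], so a color invariant under negation agrees on
    them. *)
Lemma not_forces_rainbow_le (p k r : nat) : prime p -> 2 < p -> 0 < k ->
  r <= (p + 1) %/ 2 -> ~~ forces_rainbow (p ^ k) (Posz p) r.
Proof.
move=> p_prime p_gt2 k_gt0 ler.
have p_dvd : p %| p ^ k by rewrite -{1}[p]expn1 dvdn_exp2l.
have le_pn : p <= p ^ k by rewrite dvdn_leq // expn_gt0 prime_gt0.
apply: (@not_forces_rainbow _ _ _ (fun x => minn (x %% p) (p - x %% p))).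
  move=> i lti; have ltip : i < p by lia.
  by exists i; [apply: leq_trans le_pn | rewrite modn_small //; lia].
move=> x1 x2 x3 /(congr1 (modn^~ p)); rewrite !modn_dvdm // modnMr => eq0 q.
apply/orP; left; apply/eqP; congr minn.
have := ltn_pmod x1 (prime_gt0 p_prime); have := ltn_pmod x2 (prime_gt0 p_prime).
have : p %| x1 %% p + x2 %% p by rewrite /dvdn modnDm eq0.
case/dvdnP => -[|[|j]]; nia.
Qed.

(** If [x1] and [x2] differ in color, neither is divisible by 3 and they are not opposite mod 9;
    then 3 does not divide [x3], which shares one of their two colors. *)
Lemma not_forces_rainbow_pow3 (k r : nat) : 1 < k -> r <= 3 ->
  ~~ forces_rainbow (3 ^ k) (Posz 3) r.
Proof.
move=> k_gt1 r_le3.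
have dvd9 : 9 %| 3 ^ k by rewrite (@dvdn_exp2l 3 2).
have le9 : 9 <= 3 ^ k by rewrite dvdn_leq // expn_gt0.
pose g x := if x %% 3 == 0 then 0 else
  if (x %% 9 == 1) || (x %% 9 == 8) then 1 else 2.
apply: (@not_forces_rainbow _ _ _ g).
  by move=> [|[|[|i]]] lti; [exists 0|exists 1|exists 2|lia] => //; apply: leq_trans le9.
move=> x1 x2 x3 /(congr1 (modn^~ 9)); rewrite !modn_dvdm // => eq9 q.
have : [|| g x1 == g x2, g x1 == g x3 | g x2 == g x3].
  by rewrite /g; do !case: ifP => //=; lia.
by case/or3P => /eqP ->; rewrite eqxx ?orbT.
Qed.

Lemma rb_eq (n : nat) (k : int) (r : nat) : forces_rainbow n k r ->
  (forall q, q < r -> ~~ forces_rainbow n k q) -> rb n k = r.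
Proof.
move=> fr nfr; rewrite /rb; case: ex_minnP => q fq minq.
apply/eqP; rewrite eqn_leq minq //= leqNgt.
by apply: contraL fq => /nfr.
Qed.

Theorem theorem4 (p alpha : nat) (hp : prime p) (hp3 : 3 <= p)
    (halpha : 1 <= alpha) :
  [/\ p = 3 -> alpha = 1 -> rb (p ^ alpha) (Posz p) = 3,
      p = 3 -> 2 <= alpha -> rb (p ^ alpha) (Posz p) = 4
    & 5 <= p -> rb (p ^ alpha) (Posz p) = (p + 1) %/ 2 + 1].
Proof.
split=> [p3 a1|p3 a2|p5].
- apply: rb_eq => [|q ltq]; first by apply: forces_rainbow_above; lia.
  by apply: not_forces_rainbow_le; lia.
- apply: rb_eq => [|q ltq]; first by apply: forces_rainbow_above; lia.
  by rewrite p3; apply: not_forces_rainbow_pow3.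
- apply: rb_eq => [|q ltq]; first by apply: forces_rainbow_above; lia.
  by apply: not_forces_rainbow_le; lia.
Qed.
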